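(* Let $s,k$ be integers with $s<k=o(\log n)$, where $n$ is the input length, and let $r<w$ be positive reals. Any randomized online algorithm using at most $s$ bits of memory for the $(n,k,r,w)$-Parity for Number of Hats problem is (no better than) $\frac{r+7w}{8r}$-competitive in expectation: there is a feasible input on which the expected cost of its output is at least $\frac{r+7w}{8}$.
   Context: A randomized online algorithm produces its answer $y_i$ from $x_1,\dots,x_i$ and a uniformly random bit string; it is $c$-competitive in expectation if there is $\alpha\ge 0$ with $\mathbb{E}[cost(R(I))]\le c\cdot cost(Opt(I))+\alpha$ for all inputs $I$, $Opt$ an optimal offline algorithm. It uses at most $s$ bits of memory if it stores at most $s$ bits while processing any input. For $X\in\{0,1\}^m$ with $\#_1(X)=v\cdot 2^k$, $v$ an integer, $PartialMOD_m^k(X)=v\bmod 2$. The $(n,k,r,w)$-Parity for Number of Hats problem: feasible inputs are $I=(2,X_1,2,X_2,2,X_3)$ of length $n=m_1+m_2+m_3+3$, with $m_i\ge 2^{k+1}$, $X_i\in\{0,1\}^{m_i}$, $\#_1(X_i)$ a multiple of $2^k$. Let $y_1,y_2,y_3$ be the output bits at the three requests with value $2$ and $z_j=\bigoplus_{i=j}^{3}PartialMOD_{m_i}^k(X_i)$. The cost is $r$ if $y_j=z_j$ for all $j$, and $w$ otherwise, with $r<w$. *)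

(* Defs.v *)
From mathcomp Require Import all_boot all_order all_algebra.
From mathcomp Require Import all_classical all_reals all_analysis.

Set Implicit Arguments.
Unset Strict Implicit.
Unset Printing Implicit Defensive.

Import Order.TTheory GRing.Theory Num.Theory.
Local Open Scope ring_scope.

Definition request := 'I_3.
Definition hat : request := ord_max.
Definition bit (b : bool) : request := inord b.

(* Everything the algorithm retains about the past requests, the current
   position included, is in its memory, a bit string; [tape] is the
   uniformly random bit string, which is available throughout the computation
   and is not counted as memory.  The answer y_i is computed from the random
   string, the memory left by x_1, ..., x_(i-1), and x_i.  Memory is unbounded
   here, so it may record the whole past: every family of functions
   y_i(tape, x_1, ..., x_i) is of this form. *)
Record randomized_online_algorithm := RandomizedOnlineAlgorithm {
  tape_length : nat;
  tape := tape_length.-tuple bool;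
  init : tape -> seq bool;
  next : tape -> seq bool -> request -> seq bool;
  answer : tape -> seq bool -> request -> bool }.

Definition memory (A : randomized_online_algorithm) (psi : tape A)
    (p : seq request) : seq bool :=
  foldl (next psi) (init psi) p.

Definition answers (A : randomized_online_algorithm) (psi : tape A)
    (x : seq request) : seq bool :=
  [seq answer psi (memory psi (take i x)) (nth hat x i) | i <- iota 0 (size x)].

(* Meaningful when the number of ones in X is a multiple v * 2 ^ k. *)
Definition PartialMOD (k : nat) (X : seq bool) : bool :=
  odd (count id X %/ 2 ^ k).

(* The instance (2, X_1, 2, X_2, 2, X_3). *)
Definition hats_input (X : 'I_3 -> seq bool) : seq request :=
  flatten [seq hat :: map bit (X i) | i <- enum 'I_3].

Definition feasible (n k : nat) (X : 'I_3 -> seq bool) : Prop :=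
  size (hats_input X) = n /\
  forall i, (2 ^ k.+1 <= size (X i))%N /\ (2 ^ k %| count id (X i))%N.

Definition z (k : nat) (X : 'I_3 -> seq bool) (j : 'I_3) : bool :=
  \big[addb/false]_(i < 3 | (j <= i)%N) PartialMOD k (X i).

Definition hat_answers (x : seq request) (Y : seq bool) : seq bool :=
  mask [seq a == hat | a <- x] Y.

Section Cost.
Variables (R : realType) (k : nat) (r w : R).

(* Y is the sequence of all answers, one for each request. *)
Definition cost (X : 'I_3 -> seq bool) (Y : seq bool) : R :=
  if hat_answers (hats_input X) Y == [seq z k X j | j <- enum 'I_3]
  then r else w.

(* The least cost of an answer sequence; when r < w, the default value w of
   the iterated minimum is an upper bound of all costs. *)
Definition opt_cost (X : 'I_3 -> seq bool) : R :=
  \big[Order.min/w]_(Y : (size (hats_input X)).-tuple bool) cost X Y.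

Definition expected_cost (A : randomized_online_algorithm)
    (X : 'I_3 -> seq bool) : R :=
  (\sum_(psi : tape A) cost X (answers psi (hats_input X)))
    / 2 ^+ tape_length A.

(* c-competitive in expectation with additive constant alpha. *)
Definition competitive_in_expectation (n : nat)
    (A : randomized_online_algorithm) (c alpha : R) : Prop :=
  forall X, feasible n k X -> expected_cost A X <= c * opt_cost X + alpha.

End Cost.

Definition uses_at_most (s n k : nat) (A : randomized_online_algorithm)
  : Prop :=
  forall X, feasible n k X ->
  forall (psi : tape A) (i : nat),
    (size (memory psi (take i (hats_input X))) <= s)%N.

(* Main.v *)
(* For a fixed random string the algorithm is an automaton with fewer than 2^k
   states.  Each X_i is 1^(2^k (1 + v)) 0^(...), where v is the sum of a uniformly
   random subset of the odd numbers below 2 * 4^k.  The blocks are longer than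
   the transient behaviour, and the cycle lengths reached on the ones and then on
   the zeros have odd parts c1, c2 < 2^k.  Adding or removing the summand c1 * c2
   changes the parity of v but neither the final state nor (c1, c2), so it is an
   involution: the parity is uniform given the final state.  The three answers
   are thus three independent fair guesses, all right with probability exactly
   1/8, and averaging over the random string yields a costly input.  Its length
   is O(32^k), which is at most n because k = o(log n). *)
Require Import Defs.
From mathcomp Require Import all_boot all_order all_algebra.
From mathcomp Require Import all_classical all_reals all_analysis.
From mathcomp Require Import zify ring lra.

Set Implicit Arguments.
Unset Strict Implicit.
Unset Printing Implicit Defensive.

Import Order.TTheory GRing.Theory Num.Theory.
Import numFieldNormedType.Exports.

(** * Layout of the instance, eventual periods of iterates, involutions *)

Lemma hats_inputE (X : 'I_3 -> seq bool) (i0 := ord0 : 'I_3)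
    (i1 := lift ord0 ord0 : 'I_3) (i2 := lift ord0 (lift ord0 ord0) : 'I_3) :
  hats_input X = hat :: map bit (X i0) ++
    (hat :: map bit (X i1) ++ hat :: map bit (X i2)).
Proof.
by rewrite /hats_input !enum_ordSl /= (size0nil (size_enum_ord 0)) /= !cats0.
Qed.

Lemma foldl_map (T1 T2 S : Type) (h : T1 -> T2) (f : S -> T2 -> S) x s :
  foldl f x (map h s) = foldl (fun y a => f y (h a)) x s.
Proof. by elim: s x => //= a s IHs x; rewrite IHs. Qed.

Lemma foldl_nseq (S T : Type) (f : S -> T -> S) x n a :
  foldl f x (nseq n a) = iter n (f^~ a) x.
Proof. by elim: n x => //= n IHn x; rewrite IHn -iterSr. Qed.

Lemma iter_period (T : Type) (f : T -> T) x i c d t :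
  iter (i + c) f x = iter i f x -> i <= t ->
  iter (t + c * d) f x = iter t f x.
Proof.
move=> eqf le_it; elim: d => [|d IHd]; first by rewrite muln0 addn0.
have -> : t + c * d.+1 = t + c * d - i + (i + c) by lia.
by rewrite iterD eqf -iterD subnK ?IHd //; lia.
Qed.

(** By pigeonhole the orbit repeats with some period d < 2^k after fewer than 2^k steps. The 2-part
    of d divides 2^k, so 2^k times the odd part c of d is a multiple of d. *)
Lemma iter_odd_period (T : eqType) (k : nat) (B : seq T) (f : T -> T) x :
  size B < 2 ^ k -> (forall i, i < 2 ^ k -> iter i f x \in B) ->
  exists c, [/\ odd c, c < 2 ^ k &
    forall t, 2 ^ k <= t -> iter (t + 2 ^ k * c) f x = iter t f x].
Proof.
move=> ltBk fB; set n := (2 ^ k).-1.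
have nS : n.+1 = 2 ^ k by rewrite prednK ?expn_gt0.
have /trajectP[i lt_in eqf] : looping f x n.
  apply: contraLR ltBk; rewrite -looping_uniq -leqNgt => Ut.
  rewrite -nS -(size_traject f x n.+1); apply: uniq_leq_size => // y.
  by case/trajectP=> j ltj ->; apply: fB; rewrite -nS.
pose d := n - i; have d_gt0 : 0 < d by rewrite /d; lia.
have [part_d le_oddd] := (partnC 2 d_gt0, dvdn_leq d_gt0 (dvdn_part 2^' d)).
exists d`_2^'; split; first by rewrite odd_2'nat part_pnat.
  by rewrite -nS ltnS (leq_trans le_oddd) // /d; lia.
move=> t le_kt; have le_it : i <= t by lia.
have /dvdnP[e def_e] : d %| 2 ^ k * d`_2^'.
  rewrite -[X in X %| _]part_d dvdn_mul // p_part dvdn_exp2l //.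
  rewrite -(@leq_exp2l 2) // -p_part.
  by rewrite (leq_trans (dvdn_leq d_gt0 (dvdn_part 2 d))) // /d; lia.
rewrite def_e mulnC; apply: iter_period le_it.
by rewrite -eqf /d subnKC // ltnW.
Qed.

Lemma card_involution_half (T : finType) (f : T -> T) (P : pred T) :
  injective f -> (forall x, P (f x) = ~~ P x) -> (#|P| * 2 = #|T|)%N.
Proof.
move=> f_inj Pf; rewrite -(cardC P) muln2 -addnn; congr addn.
rewrite -!sum1_card [RHS](reindex_inj f_inj) /=.
by apply: eq_bigl => x; rewrite !inE -!topredE /= Pf negbK.
Qed.

(** * Random blocks and the unpredictability of their parity *)

Section Word.
Variables k m : nat.
Hypothesis m_big : 2 ^ k * (16 ^ k + 2) <= m.

Definition code := {ffun 'I_(4 ^ k) -> bool}.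

Definition weight (e : code) : nat := \sum_i e i * i.*2.+1.

(** The successor guarantees 2^k ones even at weight 0, enough for the run on ones to become
    periodic. *)
Definition word (e : code) : seq bool :=
  nseq (2 ^ k * (weight e).+1) true ++ nseq (m - 2 ^ k * (weight e).+1) false.

Definition flip (j : 'I_(4 ^ k)) (e : code) : code :=
  [ffun i => e i (+) (i == j)].

Lemma flipK j : involutive (flip j).
Proof. by move=> e; apply/ffunP => i; rewrite !ffunE addbK. Qed.

(** The summand 2j+1 is added to whichever of the two codes lacks it; this form avoids truncated
    subtraction. *)
Lemma weight_flip j e :
  weight (flip j e) + e j * j.*2.+1 = weight e + ~~ e j * j.*2.+1.
Proof.
rewrite /weight (bigD1 j) //= [X in _ = X + _](bigD1 j) //= ffunE eqxx addbT.
under eq_bigr => i /negPf ij do rewrite ffunE ij addbF.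
by case: (e j) => /=; lia.
Qed.

(** The first 4^k odd numbers add up to (4^k)^2 = 16^k. *)
Lemma weight_le e : weight e <= 16 ^ k.
Proof.
have sum_odd n : \sum_(i < n) i.*2.+1 = n * n.
  by elim: n => [|n IHn]; rewrite ?big_ord0 // big_ord_recr /= IHn; lia.
rewrite -[16]/(4 * 4) expnMn -sum_odd; apply: leq_sum => i _.
by case: (e i); lia.
Qed.

(** At least 2^k zeros remain, so the run on zeros gets past its transient too. *)
Lemma ones_le e : 2 ^ k * (weight e).+1 + 2 ^ k <= m.
Proof.
by apply: leq_trans m_big; rewrite -mulnSr leq_mul2l addn2 !ltnS weight_le orbT.
Qed.

Lemma size_word e : size (word e) = m.
Proof. by rewrite size_cat !size_nseq; have := ones_le e; lia. Qed.

Lemma count_word e : count id (word e) = 2 ^ k * (weight e).+1.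
Proof. by rewrite count_cat !count_nseq mul1n mul0n addn0. Qed.

Lemma PartialMOD_word e : PartialMOD k (word e) = odd (weight e).+1.
Proof. by rewrite /PartialMOD count_word mulKn ?expn_gt0. Qed.

Lemma PartialMOD_flip j e :
  PartialMOD k (word (flip j e)) = ~~ PartialMOD k (word e).
Proof.
rewrite !PartialMOD_word /=; have := weight_flip j e.
by case: (e j); lia.
Qed.

Lemma foldl_word (T : Type) (f : T -> bool -> T) q e :
  foldl f q (word e) = iter (m - 2 ^ k * (weight e).+1) (f^~ false)
    (iter (2 ^ k * (weight e).+1) (f^~ true) q).
Proof. by rewrite foldl_cat !foldl_nseq. Qed.

(** Here [B] holds every state met on a prefix and [g] is any guess made from the final state. The
    involution exchanges right and wrong guesses. *)
Lemma parity_unpredictable (T : eqType) (B : seq T) (f : T -> bool -> T) q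
    (g : T -> bool) :
  size B < 2 ^ k ->
  (forall e x y, word e = x ++ y -> foldl f q x \in B) ->
  #|[pred e | PartialMOD k (word e) == g (foldl f q (word e))]| * 2
    = #|{: code}|.
Proof.
move=> ltBk fB; pose p v := iter (2 ^ k * v.+1) (f^~ true) q.
have [c1 [odd_c1 lt_c1 per1]] : exists c, [/\ odd c, c < 2 ^ k &
    forall t, 2 ^ k <= t -> iter (t + 2 ^ k * c) (f^~ true) q
                          = iter t (f^~ true) q].
  apply: iter_odd_period ltBk _ => i lt_i; rewrite -foldl_nseq.
  pose e : code := [ffun=> false].
  apply: (fB e _ (nseq (2 ^ k * (weight e).+1 - i) true ++
                  nseq (m - 2 ^ k * (weight e).+1) false)).
  by rewrite catA -nseqD subnKC //; nia.
(* One unit of weight is 2^k ones, so the period 2^k * c1 in letters is the period c1 in weight. *)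
have {per1} p_per v d : p (v + c1 * d) = p v.
  have le_t : 2 ^ k <= 2 ^ k * v.+1 by rewrite leq_pmulr.
  rewrite /p -(iter_period d (per1 _ le_t) (leqnn _)); congr iter.
  by rewrite -addSn mulnDr mulnA.
(* The second period is a function of the state after the ones alone, hence unchanged by the flip.
   The value 0 is a default for states whose orbit leaves [B]. *)
have /choice[c c_per] : forall p0, exists c2,
    (forall i, i < 2 ^ k -> iter i (f^~ false) p0 \in B) ->
    [/\ odd c2, c2 < 2 ^ k & forall t, 2 ^ k <= t ->
      iter (t + 2 ^ k * c2) (f^~ false) p0 = iter t (f^~ false) p0].
  move=> p0; case: (pselect (forall i, i < 2 ^ k ->
      iter i (f^~ false) p0 \in B)) => [p0B|p0B]; last by exists 0.
  by have [c2 c2P] := iter_odd_period ltBk p0B; exists c2.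
have {}c_per e : [/\ odd (c (p (weight e))), c (p (weight e)) < 2 ^ k &
    forall t, 2 ^ k <= t ->
      iter (t + 2 ^ k * c (p (weight e))) (f^~ false) (p (weight e))
      = iter t (f^~ false) (p (weight e))].
  apply: c_per => i lt_i; rewrite /p -!foldl_nseq -foldl_cat.
  apply: (fB e _ (nseq (m - 2 ^ k * (weight e).+1 - i) false)).
  by rewrite -catA -nseqD subnKC //; have := ones_le e; lia.
have K_gt0 : 0 < 4 ^ k by rewrite expn_gt0.
(* The index of the odd summand c1 * c2 = 2j+1, in range because c1 * c2 < 4^k; the default of
   [insubd] never occurs. *)
pose j e : 'I_(4 ^ k) := insubd (Ordinal K_gt0) (c1 * c (p (weight e)))./2.
have jE e : (j e).*2.+1 = c1 * c (p (weight e)).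
  have [odd_c lt_c _] := c_per e.
  have odd_cc : odd (c1 * c (p (weight e))) by rewrite oddM odd_c1.
  rewrite val_insubd; case: ifPn => [_|]; first by lia.
  by case/negP; rewrite -[4]/(2 * 2) expnMn; nia.
have weight_j e : weight (flip (j e) e) = weight e + c1 * c (p (weight e)) \/
    weight e = weight (flip (j e) e) + c1 * c (p (weight e)).
  by rewrite -jE; have := weight_flip (j e) e; case: (e _); lia.
have p_flip e : p (weight (flip (j e) e)) = p (weight e).
  by case: (weight_j e) => [->|->]; rewrite p_per.
have j_flip e : j (flip (j e) e) = j e by rewrite /j p_flip.
(* The zeros change by 2^k * c1 * c2, opposite to the ones: a multiple of their period, with at
   least 2^k zeros on both sides. *)
have fold_flip e : foldl f q (word (flip (j e) e)) = foldl f q (word e).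
  rewrite !foldl_word -!/(p _) p_flip.
  have [_ _ per] := c_per e.
  have [le1 le2] := (ones_le e, ones_le (flip (j e) e)).
  have shift t : 2 ^ k <= t ->
      iter (t + 2 ^ k * (c1 * c (p (weight e)))) (f^~ false) (p (weight e))
      = iter t (f^~ false) (p (weight e)).
    move=> le_t; rewrite -(iter_period c1 (per _ le_t) (leqnn _)).
    by congr iter; rewrite -mulnA [c1 * _]mulnC.
  case: (weight_j e) => eq_w.
    rewrite -[LHS]shift; last by lia.
    by congr iter; have := congr1 (muln (2 ^ k)) eq_w; rewrite mulnDr; lia.
  rewrite -[RHS]shift; last by lia.
  by congr iter; have := congr1 (muln (2 ^ k)) eq_w; rewrite mulnDr; lia.
apply: (@card_involution_half _ (fun e => flip (j e) e)).
  by apply: can_inj (fun e => flip (j e) e) _ => e; rewrite j_flip flipK.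
move=> e; rewrite /= fold_flip PartialMOD_flip.
by case: (PartialMOD _ _); case: (g _).
Qed.

End Word.

(** * Answers at the three hats *)

Definition three_words (X1 X2 X3 : seq bool) (i : 'I_3) : seq bool :=
  nth [::] [:: X1; X2; X3] i.

Lemma bit_neq_hat b : (bit b == hat) = false.
Proof. by rewrite /bit -val_eqE /= inordK; case: b. Qed.

Section Answers.
Variables (A : randomized_online_algorithm) (psi : tape A).

(** Generalizes [answers] to any starting memory, to allow induction along the input. *)
Definition answers_from (q : seq bool) (x : seq request) : seq bool :=
  [seq answer psi (foldl (Defs.next psi) q (take i x)) (nth hat x i)
     | i <- iota 0 (size x)].

Lemma answers_from_cons q a x :
  answers_from q (a :: x) = answer psi q a :: answers_from (Defs.next psi q a) x.
Proof. by rewrite /answers_from /= -(addn0 1) iotaDl -map_comp. Qed.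

Lemma hat_answers_cons q x :
  hat_answers (hat :: x) (answers_from q (hat :: x))
  = answer psi q hat :: hat_answers x (answers_from (Defs.next psi q hat) x).
Proof. by rewrite answers_from_cons. Qed.

Lemma hat_answers_bits q X x :
  hat_answers (map bit X ++ x) (answers_from q (map bit X ++ x))
  = hat_answers x (answers_from (foldl (Defs.next psi) q (map bit X)) x).
Proof.
elim: X q => //= b X IHX q.
by rewrite -IHX answers_from_cons /hat_answers /= bit_neq_hat.
Qed.

End Answers.

Lemma z_seq k X1 X2 X3 :
  let P := PartialMOD k in
  [seq z k (three_words X1 X2 X3) j | j <- enum 'I_3]
  = [:: P X1 (+) (P X2 (+) P X3); P X2 (+) P X3; P X3].
Proof.
rewrite !enum_ordSl /= (size0nil (size_enum_ord 0)) /= /z.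
rewrite ![\big[_/_]_(i < 3 | _) _]big_mkcond /= !big_ord_recl.
by rewrite !big_ord0 /= !addbF.
Qed.

(** Each hat is answered before its block is read, so the answer depends only on the memory left by
    the earlier blocks. *)
Lemma hat_answers_three (A : randomized_online_algorithm) (psi : tape A)
    X1 X2 X3 (x := hats_input (three_words X1 X2 X3))
    (f := fun q b => Defs.next psi q (bit b)) (q0 := init psi)
    (q1 := foldl f (Defs.next psi q0 hat) X1)
    (q2 := foldl f (Defs.next psi q1 hat) X2) :
  hat_answers x (answers psi x)
  = [:: answer psi q0 hat; answer psi q1 hat; answer psi q2 hat].
Proof.
rewrite -[answers _ _]/(answers_from psi q0 x) /x hats_inputE /=.
rewrite !(hat_answers_cons, hat_answers_bits).
rewrite -[map bit X3]cats0 hat_answers_bits /= /q2 /q1 /f !foldl_map.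
by rewrite /hat_answers.
Qed.

(** There are 2^(s+1) - 1 bit strings of length at most s. *)
Lemma card_bseq_lt s k : s < k -> size (enum {: s.-bseq bool}) < 2 ^ k.
Proof.
move=> lt_sk; rewrite -cardT card_bseq card_bool.
apply: leq_trans (leq_pexp2l _ lt_sk) => //.
by rewrite -[2 ^ s.+1]prednK ?expn_gt0 // predn_exp mul1n.
Qed.

(** * Three independent blocks and averaging over them *)

Section ThreeHats.
Variables (n k m3 : nat).
Let m := 2 ^ k * (16 ^ k + 2).
Hypothesis m_le_m3 : m <= m3.
Hypothesis nE : n = m + m + m3 + 3.

Definition triple := (code k * code k * code k)%type.

(** The third block is padded with zeros to bring the total length to n. *)
Definition hard_input (e : triple) : 'I_3 -> seq bool :=
  three_words (word m e.1.1) (word m e.1.2) (word m3 e.2).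

Lemma hard_input_feasible e : feasible n k (hard_input e).
Proof.
have ge_m : 2 ^ k.+1 <= m by rewrite expnSr leq_mul2l addn2 orbT.
split.
  rewrite hats_inputE /= size_cat /= size_cat /= !size_map.
  by rewrite /hard_input /three_words /= !size_word //; lia.
case=> [[|[|[|i]]] lt_i] //; rewrite /hard_input /three_words /=;
  by rewrite size_word // count_word // dvdn_mulr //; split=> //;
  apply: leq_trans m_le_m3.
Qed.

Section Correct.
Variables (s : nat) (A : randomized_online_algorithm) (psi : tape A).
Hypothesis s_lt_k : s < k.
Hypothesis mem_s : uses_at_most s n k A.

Definition correct (X : 'I_3 -> seq bool) : bool :=
  hat_answers (hats_input X) (answers psi (hats_input X))
    == [seq z k X j | j <- enum 'I_3].

(** The conditions y_j = z_j are triangular: the parity of X_i must equal y_i xor y_(i+1), or y_3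
    when i = 3. As y_(i+1) is a function of the memory after X_i, each condition holds for half of
    the codes, whatever the earlier blocks. *)
Lemma sum_correct :
  (\sum_(e : triple) correct (hard_input e)) * 8 = #|{: triple}|.
Proof.
pose f q b := Defs.next psi q (bit b); pose B := map val (enum {: s.-bseq bool}).
have ltB : size B < 2 ^ k by rewrite size_map card_bseq_lt.
have memB e x y : hats_input (hard_input e) = x ++ y ->
    foldl (Defs.next psi) (init psi) x \in B.
  move=> def_xy; have := mem_s (hard_input_feasible e) psi (size x).
  rewrite def_xy take_size_cat // => le_s.
  by apply/mapP; exists (Bseq le_s); rewrite ?mem_enum.
have half M (g : seq bool -> bool) q : m <= M ->
    (forall (e : code k) x y, word M e = x ++ y -> foldl f q x \in B) ->
    (\sum_(e : code k) (PartialMOD k (word M e) == g (foldl f q (word M e)))) * 2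
    = #|{: code k}|.
  move=> le_mM fB; rewrite -(parity_unpredictable le_mM g ltB fB) -sum1_card.
  by rewrite [in RHS]big_mkcond /=; congr (_ * 2);
    apply: eq_bigr => e _; rewrite inE; case: (_ == _).
pose a q := answer psi q hat; pose h q := Defs.next psi q hat.
pose q0 := init psi; pose q1 (e : code k) := foldl f (h q0) (word m e).
pose q2 (e e' : code k) := foldl f (h (q1 e)) (word m e').
have half3 (e1 e2 : code k) :
    (\sum_(e3 : code k) (PartialMOD k (word m3 e3) == a (q2 e1 e2))) * 2
    = #|{: code k}|.
  apply: (half m3 (fun=> a (q2 e1 e2)) (h (q2 e1 e2))) => // e x y def_xy.
  have := memB (e1, e2, e) (hat :: map bit (word m e1) ++
    (hat :: map bit (word m e2) ++ hat :: map bit x)) (map bit y).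
  rewrite hats_inputE /= foldl_cat /= foldl_cat /= !foldl_map; apply.
  by rewrite -catA /= -catA /= -map_cat -def_xy.
have half2 (e1 : code k) :
    (\sum_(e2 : code k)
       (PartialMOD k (word m e2) == a (q1 e1) (+) a (q2 e1 e2))) * 2
    = #|{: code k}|.
  apply: (half m (fun q => a (q1 e1) (+) a q) (h (q1 e1))) => // e x y def_xy.
  (* The unread block is filled arbitrarily, to exhibit a prefix of a feasible input. *)
  have := memB (e1, e, [ffun=> false]) (hat :: map bit (word m e1) ++
    hat :: map bit x) (map bit y ++ hat :: map bit (word m3 [ffun=> false])).
  rewrite hats_inputE /= foldl_cat /= !foldl_map; apply.
  by rewrite -catA /= catA -map_cat -def_xy.
have half1 :
    (\sum_(e1 : code k) (PartialMOD k (word m e1) == a q0 (+) a (q1 e1))) * 2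
    = #|{: code k}|.
  apply: (half m (fun q => a q0 (+) a q) (h q0)) => // e x y def_xy.
  have := memB (e, [ffun=> false], [ffun=> false]) (hat :: map bit x)
    (map bit y ++ hat :: map bit (word m [ffun=> false])
      ++ hat :: map bit (word m3 [ffun=> false])).
  rewrite hats_inputE /= !foldl_map; apply.
  by rewrite catA -map_cat -def_xy.
rewrite -(pair_bigA _ (fun e12 e3 => correct (hard_input (e12, e3)) : nat)) /=.
rewrite -(pair_bigA _ (fun e1 e2 => \sum_e3 correct (hard_input (e1, e2, e3)))) /=.
have -> : \sum_e1 \sum_e2 \sum_e3 correct (hard_input (e1, e2, e3)) =
   \sum_(e1 : code k) (PartialMOD k (word m e1) == a q0 (+) a (q1 e1)) *
     \sum_(e2 : code k) (PartialMOD k (word m e2) == a (q1 e1) (+) a (q2 e1 e2)) *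
     \sum_(e3 : code k) (PartialMOD k (word m3 e3) == a (q2 e1 e2)).
  apply: eq_bigr => e1 _; rewrite big_distrr; apply: eq_bigr => e2 _ /=.
  rewrite mulnA big_distrr; apply: eq_bigr => e3 _ /=.
  rewrite /correct hat_answers_three z_seq /= !eqseq_cons andbT mulnb mulnb;
    congr nat_of_bool.
  rewrite -/f -/(q1 _) -/(q2 _ _) -!/(a _) -/q0.
  rewrite -/(h _) -/(q1 _) -/(h _) -/(q2 _ _).
  by do 3!case: (PartialMOD _ _); do 3!case: (a _).
rewrite !card_prod; set N := #|_| in half1 half2 half3 *.
(* The innermost sum is the same for all outer codes, so the halves multiply. *)
have sum2 (e1 : code k) : (\sum_(e2 : code k)
     (PartialMOD k (word m e2) == a (q1 e1) (+) a (q2 e1 e2)) *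
     \sum_(e3 : code k) (PartialMOD k (word m3 e3) == a (q2 e1 e2))) * 4 = N * N.
  rewrite -[4]/(2 * 2) mulnA -{1}(half2 e1) mulnAC; congr (_ * 2).
  rewrite !big_distrl /=; apply: eq_bigr => e2 _.
  by rewrite -mulnA half3.
rewrite -[8]/(4 * 2) mulnA; transitivity ((\sum_(e1 : code k)
    (PartialMOD k (word m e1) == a q0 (+) a (q1 e1))) * (N * N) * 2);
  last by rewrite mulnAC half1 mulnA.
congr (_ * 2); rewrite !big_distrl /=; apply: eq_bigr => e1 _.
by rewrite -mulnA sum2.
Qed.

End Correct.

Local Open Scope ring_scope.

(** For each random string the mean cost over triples is (r + 7w)/8. Exchanging the sums gives the
    same mean for the expected cost, so some triple reaches it. *)
Lemma exists_costly_input (R : realType) (r w : R) (s : nat)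
    (A : randomized_online_algorithm) : (s < k)%N -> uses_at_most s n k A ->
  exists e, (r + 7 * w) / 8 <= expected_cost k r w A (hard_input e).
Proof.
move=> s_lt_k mem_s; apply: contrapT => /forallNP cheap.
pose N : R := #|{: triple}|%:R; set v := (r + 7 * w) / 8 in cheap.
have sum_cost (psi : tape A) : \sum_e cost k r w (hard_input e)
    (answers psi (hats_input (hard_input e))) = N * v.
  rewrite (eq_bigr (fun e => w - (w - r) * (correct psi (hard_input e))%:R)).
    rewrite sumrB sumr_const -mulr_sumr -natr_sum.
    have := congr1 (fun i => i%:R : R) (sum_correct psi s_lt_k mem_s).
    by rewrite natrM -[w *+ _]mulr_natr -/N /v => <-; field.
  move=> e _; rewrite /cost -/(correct _ _); case: (correct _ _);
    by rewrite ?mulr1 ?mulr0; ring.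
have : \sum_e expected_cost k r w A (hard_input e) = N * v.
  rewrite -mulr_suml exchange_big /= (eq_bigr _ (fun psi _ => sum_cost psi)).
  rewrite sumr_const card_tuple card_bool.
  by rewrite -[_ *+ (2 ^ _)%N]mulr_natr natrX mulfK.
apply/eqP; rewrite lt_eqF // mulrC mulr_natr -sumr_const; apply: ltr_sum.
  by apply/hasP; exists ([ffun=> false], [ffun=> false], [ffun=> false]);
    rewrite ?mem_index_enum.
by move=> e _; rewrite ltNge; apply/negP/cheap.
Qed.

End ThreeHats.

Local Open Scope ring_scope.

(** * Optimal cost, input length and conclusion *)

Lemma mask_onto (T : Type) (x0 : T) (b : seq bool) (l : seq T) :
  size l = count id b -> exists2 Y, size Y = size b & mask b Y = l.
Proof.
elim: b l => [|[] b IHb] l /=; first by move/size0nil->; exists [::].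
  by case: l => // a l [/IHb[Y szY <-]]; exists (a :: Y); rewrite /= ?szY.
by move=> /IHb[Y szY <-]; exists (x0 :: Y); rewrite /= ?szY.
Qed.

(** An offline answer sequence can carry the right bits at the three hats and anything elsewhere. *)
Lemma opt_costE (R : realType) k (r w : R) X : r < w -> opt_cost k r w X = r.
Proof.
move=> /ltW le_rw; rewrite /opt_cost; apply/eqP; rewrite eq_le; apply/andP; split.
  have count_bits Z : count id [seq a == hat | a <- map bit Z] = 0%N.
    by elim: Z => //= b Z ->; rewrite bit_neq_hat.
  have [|Y szY Y_z] := @mask_onto _ false [seq a == hat | a <- hats_input X]
    [seq z k X j | j <- enum 'I_3].
    rewrite size_map size_enum_ord hats_inputE /= map_cat /= map_cat /=.
    by rewrite count_cat /= count_cat /= !count_bits.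
  have /eqP szY' : size Y = size (hats_input X) by rewrite szY size_map.
  apply: le_trans (bigmin_le_cond _ _ (isT : predT (Tuple szY'))) _.
  by rewrite /cost /hat_answers Y_z eqxx.
apply: le_bigmin => // Y _; rewrite /cost.
by case: ifP.
Qed.

Local Open Scope classical_set_scope.

Lemma size_hard_input_le (R : realType) (k : nat -> nat) :
  (forall n, 0 < k n)%N ->
  (fun n => (k n)%:R : R) =o_\oo (fun n => ln n%:R : R) ->
  exists N, forall n, (N <= n)%N ->
    (3 * (2 ^ k n * (16 ^ k n + 2)) + 3 <= n)%N.
Proof.
(* With k <= (ln n)/10 and t = 2^k >= 2, the length 3t(t^4 + 2) + 3 is below t^10 <= e^(10k) <=
   n. *)
move=> k_gt0 /eqoP/(_ 10^-1); rewrite invr_gt0 ltr0n => /(_ isT)[N _ kN].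
exists (maxn N 1) => n; rewrite geq_max => /andP[/kN/= le_k n_gt0].
have n_gt0R : 0 < n%:R :> R by rewrite ltr0n.
have : (2 ^ (10 * k n) <= n)%N.
  rewrite -(ler_nat R) natrX -[n%:R]lnK ?posrE //.
  apply: le_trans (_ : expR 1 ^+ (10 * k n) <= _).
    by rewrite lerXn2r ?nnegrE ?expR_ge0 //; have := expR_ge1Dx (1 : R); lra.
  rewrite -expRM_natl mulr1 ler_expR natrM.
  move: le_k; rewrite ger0_norm // ger0_norm ?ln_ge0 ?ler1n //; lra.
have : (2 ^ 1 <= 2 ^ k n)%N by rewrite leq_exp2l.
have -> : (16 ^ k n = (2 ^ k n) ^ 4)%N by rewrite -[16%N]/(2 ^ 4)%N -!expnM mulnC.
rewrite [(10 * _)%N]mulnC expnM; move: (2 ^ k n)%N => t t_ge2.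
by apply: leq_trans; nia.
Qed.

Theorem theorem3 (R : realType) (s k : nat -> nat) (r w : R)
  (s_lt_k : forall n, (s n < k n)%N)
  (k_o_log : (fun n => (k n)%:R : R) =o_\oo (fun n => ln n%:R : R))
  (r_gt0 : 0 < r) (r_lt_w : r < w) :
  exists N : nat, forall n : nat, (N <= n)%N ->
  forall A : randomized_online_algorithm, uses_at_most (s n) n (k n) A ->
    (exists2 X : 'I_3 -> seq bool,
        feasible n (k n) X &
        (r + 7 * w) / 8 <= expected_cost (k n) r w A X) /\
    (forall c alpha : R, 0 <= alpha ->
        competitive_in_expectation (k n) r w n A c alpha ->
        (r + 7 * w) / (8 * r) <= c + alpha / r).
Proof.
have k_gt0 n : (0 < k n)%N by apply: leq_ltn_trans (s_lt_k n).
have [N leN] := size_hard_input_le k_gt0 k_o_log.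
exists N => n /leN le_n A mem_s; set m := (2 ^ _ * _)%N in le_n.
pose m3 := (n - (m + m + 3))%N.
have le_m3 : (m <= m3)%N by rewrite /m3; lia.
have nE : n = (m + m + m3 + 3)%N by rewrite /m3; lia.
have [e costly] := exists_costly_input le_m3 nE r w (s_lt_k n) mem_s.
have feas := hard_input_feasible le_m3 nE e.
split=> [|c alpha _ /(_ _ feas)]; first by exists (hard_input m3 e).
(* The optimum is r here, so (r + 7w)/8 <= c * r + [alpha]; it remains to divide by r. *)
rewrite opt_costE // => /(le_trans costly) le_c.
by rewrite invfM mulrA ler_pdivrMr // [leRHS]mulrDl divfK ?gt_eqF.
Qed.
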